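(* Let $\mathcal{G}$ be a monotone class of graphs (closed under taking subgraphs) and let $r\ge 2$. The following are equivalent: (i) $\mathcal{G}$ is hyperfinite; (ii) $\mathcal{G}$ is fractionally-$\mathrm{tw}$-fragile and has bounded maximum degree; (iii) $\mathcal{G}$ is fractionally-$\mathrm{cc}$-fragile; (iv) $\mathcal{A}_{\mathcal{G}}^{(r)}$ is $\mathrm{cc}$-pliable.
   Context: $\mathrm{cc}(G)$ is the maximum number of vertices of a connected component of $G$. $\mathcal{G}$ is hyperfinite if for every $\varepsilon>0$ there is $k$ such that every $G\in\mathcal{G}$ has a set $F$ of at most $\varepsilon|E(G)|$ edges with $\mathrm{cc}(G-F)\le k$. A distribution $\pi$ over subsets of $V$ is $\varepsilon$-thin if $\Pr_{X\sim\pi}[v\in X]\le\varepsilon$ for all $v\in V$. For a graph parameter $p$, $\mathcal{G}$ is fractionally-$p$-fragile if for every $\varepsilon>0$ there is $k$ such that every $G\in\mathcal{G}$ has an $\varepsilon$-thin distribution over sets $X\subseteq V(G)$ with $p(G-X)\le k$ ($\mathrm{tw}$ = treewidth). A $\sigma$-structure $\mathbb{A}$ is a finite domain $A$ with functions $f^{\mathbb{A}}\colon A^{\mathrm{ar}(f)}\to\mathbb{Q}_{\ge0}$, $f\in\sigma$; $\mathrm{opt}(\mathbb{A},\mathbb{B})=\max_{h\colon A\to B}\sum_{f}\sum_{\bar x}f^{\mathbb{A}}(\bar x)f^{\mathbb{B}}(h(\bar x))$; $d_{\mathrm{opt}}(\mathbb{A},\mathbb{B})=\sup_{\mathbb{C}}|\ln\mathrm{opt}(\mathbb{A},\mathbb{C})-\ln\mathrm{opt}(\mathbb{B},\mathbb{C})|$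 over $\sigma$-structures $\mathbb{C}$ ($\ln0=-\infty$, $|\ln0-\ln0|=0$). The Gaifman graph of $\mathbb{A}$: vertex set $A$, distinct $u,v$ adjacent iff they occur together in a tuple of positive value; $\mathrm{cc}(\mathbb{A})$ is $\mathrm{cc}$ of it. A class $\mathcal{A}$ is $\mathrm{cc}$-pliable if for every $\varepsilon>0$ there is $k$ such that every $\mathbb{A}\in\mathcal{A}$ (signature $\sigma$) has a $\sigma$-structure $\mathbb{B}$ with $\mathrm{cc}(\mathbb{B})\le k$ and $d_{\mathrm{opt}}(\mathbb{A},\mathbb{B})\le\varepsilon$. $\mathcal{A}_{\mathcal{G}}^{(r)}$ is the class of all structures (any signature) with Gaifman graph in $\mathcal{G}$ and all arities at most $r$. *)

(* Defs.v *)
From HB Require Import structures.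
From Stdlib Require Import Rdefinitions.
From mathcomp Require Import Rstruct.
From mathcomp Require Import all_boot all_order all_algebra.
From mathcomp Require Import boolp classical_sets reals ereal exp.

Set Implicit Arguments.
Unset Strict Implicit.
Unset Printing Implicit Defensive.

Import Order.TTheory GRing.Theory Num.Theory.
Local Open Scope ring_scope.

Notation R := Rdefinitions.R.

Record graph := Graph {
  gn : nat;
  gadj : rel 'I_gn;
  gsym : symmetric gadj;
  girr : irreflexive gadj }.

Definition graph_class := graph -> Prop.

Definition subgraph (H G : graph) : Prop :=
  exists f : 'I_(gn H) -> 'I_(gn G),
    injective f /\ forall x y, gadj x y -> gadj (f x) (f y).

Definition monotone (C : graph_class) : Prop :=
  forall G H, C G -> subgraph H G -> C H.

(* maximum size of a connected component of (T, e) (e symmetric) *)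
Definition cc (T : finType) (e : rel T) : nat :=
  \max_(v : T) #|[set u | connect e v u]|.

Definition edges (G : graph) : {set 'I_(gn G) * 'I_(gn G)} :=
  [set p : 'I_(gn G) * 'I_(gn G) | (p.1 < p.2)%N && gadj p.1 p.2].

Definition del_edges (G : graph) (F : {set 'I_(gn G) * 'I_(gn G)}) :
  rel 'I_(gn G) :=
  fun x y => [&& gadj x y, (x, y) \notin F & (y, x) \notin F].

Definition hyperfinite (C : graph_class) : Prop :=
  forall eps : R, 0 < eps -> exists k : nat, forall G, C G ->
    exists F : {set 'I_(gn G) * 'I_(gn G)},
      [/\ F \subset edges G,
          (#|F|%:R <= eps * #|edges G|%:R)%R &
          (cc (del_edges F) <= k)%N].

Definition del_vertices_type (G : graph) (X : {set 'I_(gn G)}) : finType :=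
  {v : 'I_(gn G) | v \notin X}.
Definition del_vertices (G : graph) (X : {set 'I_(gn G)}) :
  rel (del_vertices_type X) :=
  fun u v => gadj (val u) (val v).

Definition is_tree (m : nat) (t : rel 'I_m) : Prop :=
  [/\ (0 < m)%N, symmetric t, irreflexive t,
      forall i j, connect t i j &
      forall s : seq 'I_m, ~~ [&& uniq s, (3 <= size s)%N & cycle t s]].

Definition tree_decomposition_of_width (T : finType) (e : rel T) (w : nat) :
  Prop :=
  exists (m : nat) (t : rel 'I_m) (B : 'I_m -> {set T}),
    [/\ is_tree t,
        forall v : T, exists i, v \in B i,
        forall u v : T, e u v -> exists i, (u \in B i) && (v \in B i),
        forall (v : T) (i j : 'I_m), v \in B i -> v \in B j ->
          connect [rel a b | [&& t a b, v \in B a & v \in B b]] i j &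
        forall i, (#|B i| <= w.+1)%N].

Lemma tw_exists (T : finType) (e : rel T) :
  exists w, `[< tree_decomposition_of_width e w >].
Proof.
exists #|T|.-1; apply/asboolP.
exists 1%N, (fun _ _ => false), (fun _ => [set: T]).
split.
- split => //.
  + move=> i j; rewrite (ord1 i) (ord1 j); exact: connect0.
  + move=> s; apply/negP => /and3P [us s3 _].
    have H : #|s| = size s by apply/card_uniqP.
    have : (#|s| <= #|'I_1|)%N by exact: max_card.
    by rewrite card_ord H; case: s s3 {us H} => [|? [|? [|]]].
- by move=> v; exists ord0; rewrite inE.
- by move=> u v _; exists ord0; rewrite !inE.
- by move=> v i j _ _; rewrite (ord1 i) (ord1 j); exact: connect0.
- by move=> i; rewrite cardsT; case: #|T|.
Qed.

Definition tw (T : finType) (e : rel T) : nat :=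
  ex_minn (tw_exists e).

Definition is_distribution (n : nat) (pi : {ffun {set 'I_n} -> R}) : Prop :=
  (forall X, 0 <= pi X) /\ \sum_(X : {set 'I_n}) pi X = 1.

Definition thin (n : nat) (eps : R) (pi : {ffun {set 'I_n} -> R}) : Prop :=
  forall v : 'I_n, \sum_(X : {set 'I_n} | v \in X) pi X <= eps.

Definition fractionally_fragile
  (p : forall T : finType, rel T -> nat) (C : graph_class) : Prop :=
  forall eps : R, 0 < eps -> exists k : nat, forall G, C G ->
    exists pi : {ffun {set 'I_(gn G)} -> R},
      [/\ is_distribution pi, thin eps pi &
          forall X, 0 < pi X -> (p _ (@del_vertices G X) <= k)%N].

Definition deg (G : graph) (v : 'I_(gn G)) : nat := #|[set u | gadj v u]|.

Definition bounded_degree (C : graph_class) : Prop :=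
  exists D : nat, forall G, C G -> forall v : 'I_(gn G), (deg v <= D)%N.

(* Valued structures.  A signature is the list of arities of its       *)
(* function symbols; symbols are indexed by 'I_(size s).               *)
Definition signature := seq nat.
Definition arity (s : signature) (f : 'I_(size s)) : nat := nth 0%N s f.

Unset Implicit Arguments.
Record structure (s : signature) := Struct {
  dom_size : nat;
  dom_size_gt0 : (0 < dom_size)%N;
  sfun : forall f : 'I_(size s), (arity f).-tuple 'I_dom_size -> rat;
  sfun_ge0 : forall f x, 0 <= sfun f x }.

Set Implicit Arguments.
Arguments dom_size {s}.
Arguments sfun {s}.

Definition opt (s : signature) (A B : structure s) : rat :=
  \big[Num.max/0]_(h : {ffun 'I_(dom_size A) -> 'I_(dom_size B)})
    \sum_(f : 'I_(size s)) \sum_(x : (arity f).-tuple 'I_(dom_size A))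
      sfun A f x * sfun B f (map_tuple h x).

(* |ln a - ln b| in the extended reals, with ln 0 = -oo, |ln0 - ln0| = 0 *)
Definition ln_dist (a b : rat) : \bar R :=
  if (a == 0) && (b == 0) then 0%E
  else if (a == 0) || (b == 0) then +oo%E
  else (`| ln (ratr a : R) - ln (ratr b : R) |)%:E.

Definition d_opt (s : signature) (A B : structure s) : \bar R :=
  ereal_sup [set x | exists C : structure s, x = ln_dist (opt A C) (opt B C)].

Definition gaif_adj (s : signature) (A : structure s) : rel 'I_(dom_size A) :=
  fun u v => (u != v) &&
    [exists f : 'I_(size s), exists x : (arity f).-tuple 'I_(dom_size A),
       [&& 0 < sfun A f x, u \in x & v \in x]].

Arguments gaif_adj {s} A.

Lemma gaif_sym (s : signature) (A : structure s) : symmetric (gaif_adj A).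
Proof.
move=> u v; rewrite /gaif_adj eq_sym; congr (_ && _).
apply/existsP/existsP => -[f /existsP [x /and3P [h1 h2 h3]]];
  by exists f; apply/existsP; exists x; rewrite h1 h2 h3.
Qed.

Lemma gaif_irr (s : signature) (A : structure s) : irreflexive (gaif_adj A).
Proof. by move=> u; rewrite /gaif_adj eqxx. Qed.

Definition gaifman (s : signature) (A : structure s) : graph :=
  @Graph (dom_size A) (gaif_adj A) (@gaif_sym s A) (@gaif_irr s A).

Definition cc_struct (s : signature) (A : structure s) : nat :=
  cc (@gadj (gaifman A)).

Definition struct_class := forall s : signature, structure s -> Prop.

Definition cc_pliable (SC : struct_class) : Prop :=
  forall eps : R, 0 < eps -> exists k : nat,
    forall (s : signature) (A : structure s), SC s A ->
      exists B : structure s, (cc_struct B <= k)%N /\ (d_opt A B <= eps%:E)%E.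

Definition struct_class_of (C : graph_class) (r : nat) : struct_class :=
  fun s A => C (gaifman A) /\ all (fun a => (a <= r)%N) s.

(* Main.v *)
From mathcomp Require Import boolp reals ereal sequences exp Rstruct.
From mathcomp Require Import all_boot all_order all_algebra.
From mathcomp Require Import zify ring lra.
Require Import Defs.

Set Implicit Arguments.
Unset Strict Implicit.
Unset Printing Implicit Defensive.

Import Order.TTheory GRing.Theory Num.Theory.

(** A star in a hyperfinite class must lose a constant fraction of its edges, so
    degrees are bounded. In a class of bounded degree, unweighted vertex
    separators (few vertices of any set [W] whose deletion leaves [W] with
    components of bounded size) yield separators for arbitrary weights: after
    deleting the vertices with a much heavier neighbour and a sparse family of
    weight levels, the weights are nearly constant on every component.
    Multiplicative weights turn separators for all weightings into a thin uniform
    distribution. Unweighted separators come from hyperfiniteness for (i) => (ii),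
    and for (ii) => (iii) from a rooted tree decomposition, from which one cuts off
    large subtrees bottom-up.

    For (iii) => (iv), [B] is the disjoint union of the copies of [A] from which
    the tuples meeting a random set [X] are removed, weighted by the probability
    of [X].

    For (iv) => (i), give every edge of [G] its own binary symbol, and let [K] be
    the disjoint union of the induced subgraphs of [G] on at most [k] vertices. If
    [B] has components of size at most [k], every map from [B] to [G] factors
    through [K], so opt(G, K) is almost opt(G, G) = |E(G)|, and a map from [G] to
    [K] of almost full value exhibits the edges to be deleted. *)

(** * Components and multiplicative weights *)

Definition restrict (T : finType) (e : rel T) (S : {set T}) : rel T :=
  [rel u v | [&& e u v, u \in S & v \in S]].

Lemma cc_leP (T : finType) (e : rel T) k :
  reflect (forall v, #|[set u | connect e v u]| <= k)%N (cc e <= k)%N.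
Proof. by apply: (iffP (bigmax_leqP _ _ _)) => h v *; exact: h. Qed.

Lemma sub_cc (T : finType) (e e' : rel T) k :
  subrel e e' -> (cc e' <= k)%N -> (cc e <= k)%N.
Proof.
move=> see /cc_leP h; apply/cc_leP => v; apply: leq_trans (h v).
apply/subset_leq_card/subsetP => u; rewrite !inE.
by apply: connect_sub => x y /see /connect1.
Qed.

(** Bernoulli's inequality for (1 - 1/(N+1))^q, cleared of denominators. *)
Lemma bernoulli_nat N q :
  (q <= N.+1 -> (N.+1 - q) * N.+1 ^ q <= N.+1 * N ^ q)%N.
Proof.
elim: q => [|q IH] hq; first by rewrite subn0 !expn0.
have := IH (ltnW hq); rewrite !expnS.
set a := (N.+1 ^ q)%N; set b := (N ^ q)%N => h.
have h2 : ((N.+1 - q.+1) * N.+1 <= (N.+1 - q) * N)%N by nia.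
have h3 : ((N.+1 - q.+1) * N.+1 * a <= (N.+1 - q) * N * a)%N.
  by rewrite leq_mul2r h2 orbT.
nia.
Qed.

(** Used to see that [M] rounds of growth by 1 + 1/(2M) at most double the total weight. *)
Lemma expn_succ_double M : ((2 * M).+1 ^ M <= 2 * (2 * M) ^ M)%N.
Proof.
have := @bernoulli_nat (2 * M) M ltac:(lia).
set a := ((2 * M).+1 ^ M)%N; set b := ((2 * M) ^ M)%N => h.
have h2 : ((M.+1) * a <= M.+1 * (2 * b))%N by nia.
by rewrite leq_pmul2l in h2.
Qed.

(* Multiplicative weights: every vertex that is hit doubles its weight, so the
   total weight grows by a factor at most 1 + 1/N per round. *)
Lemma multiplicative_weights (T : finType) (P : {set T} -> Prop) N :
  (forall c : T -> nat, exists2 X : {set T}, P X &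
     N * \sum_(v in X) 2 ^ c v <= \sum_v 2 ^ c v)%N ->
  forall t, exists Xs : seq {set T}, [/\ size Xs = t,
    forall X, X \in Xs -> P X &
    (N ^ t * \sum_v 2 ^ count (fun X : {set T} => v \in X) Xs <= N.+1 ^ t * #|T|)%N].
Proof.
move=> hP; elim=> [|t [Xs [sXs hXs hw]]].
  exists [::]; split=> //=.
  by rewrite !expn0 !mul1n sum_nat_const muln1.
have [X PX hX] := hP (fun v => count (fun X : {set T} => v \in X) Xs).
exists (X :: Xs); split=> /=; first by rewrite sXs.
  by move=> Y; rewrite inE => /orP [/eqP -> //|/hXs].
set w := fun v : T => (2 ^ count (fun X : {set T} => v \in X) Xs)%N.
have -> : (\sum_v 2 ^ ((v \in X) + count (fun X0 : {set T} => v \in X0) Xs) =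
           \sum_v w v + \sum_(v in X) w v)%N.
  rewrite [X in (_ = _ + X)%N]big_mkcond -big_split /=; apply: eq_bigr => v _.
  by case: (v \in X); rewrite ?add0n ?addn0 // add1n expnS mul2n -addnn.
move: hX hw; rewrite -!/(w _) !expnS.
rewrite -[X in (N * X <= _)%N]/(\sum_(v in X) w v)%N.
rewrite -[X in (_ <= X)%N -> _]/(\sum_v w v)%N.
rewrite -[X in (N ^ t * X <= _)%N]/(\sum_v w v)%N.
set a := (\sum_v w v)%N; set b := (\sum_(v in X) w v)%N => h1 h2.
have h3 : (N * (a + b) <= N.+1 * a)%N by lia.
rewrite -mulnA mulnCA (leq_trans (leq_mul (leqnn _) h3)) // mulnCA -mulnA.
by rewrite leq_mul2l h2 orbT.
Qed.

(** After [M * q] rounds the total weight is at most 2^q |T| <= 2^(2q). A vertex hit c times alone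
    weighs 2^c, so c <= 2q, a fraction 2/M of the rounds. *)
Lemma uniform_cover (T : finType) (P : {set T} -> Prop) M : (0 < M)%N ->
  (forall c : T -> nat, exists2 X : {set T}, P X &
     2 * M * \sum_(v in X) 2 ^ c v <= \sum_v 2 ^ c v)%N ->
  exists Xs : seq {set T}, [/\ (0 < size Xs)%N, forall X, X \in Xs -> P X &
    forall v, (M * count (fun X : {set T} => v \in X) Xs <= 2 * size Xs)%N].
Proof.
(* This [q] gives |T| <= 2^q and, being positive, at least one round. *)
move=> M0 hP; set q := (#|T|).+1.
have [Xs [sXs hXs hw]] := multiplicative_weights hP (M * q).
exists Xs; split; [by rewrite sXs muln_gt0 M0 | by [] | move=> v].
rewrite sXs; suff : (count (fun X : {set T} => v \in X) Xs <= 2 * q)%N by nia.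
rewrite -(leq_exp2l (m := 2)) //.
have h1 : (2 ^ count (fun X : {set T} => v \in X) Xs <=
  \sum_v 2 ^ count (fun X : {set T} => v \in X) Xs)%N.
  by rewrite (bigD1 v) //= leq_addr.
apply: leq_trans h1 _.
rewrite -(leq_pmul2l (m := ((2 * M) ^ (M * q)))); last by rewrite expn_gt0 muln_gt0 M0.
apply: leq_trans hw _.
have h5 : ((2 * M).+1 ^ (M * q) <= 2 ^ q * (2 * M) ^ (M * q))%N.
  by rewrite !expnM -expnMn leq_exp2r // expn_succ_double.
have h6 : (#|T| <= 2 ^ q)%N by apply: ltnW; apply: ltn_trans (ltn_expl q _); rewrite /q.
apply: leq_trans (leq_mul h5 h6) _.
by rewrite [(2 * q)%N]mul2n -addnn expnD mulnAC mulnC.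
Qed.

(** * From unweighted to weighted separators *)

(** Numbers less than [a] apart differ by at most one in their level [%/ a], and a step up by one
    level enters a new block of [m] levels only at a multiple of [m]. *)
Lemma eq_block_of_close a m x y : (0 < a)%N -> (0 < m)%N ->
  (x <= y)%N -> (y < x + a)%N -> ~~ (m %| y %/ a)%N ->
  (x %/ (a * m) = y %/ (a * m))%N.
Proof.
move=> a0 m0 lexy ltyx ndv; rewrite !divnMA.
have h1 : (x %/ a <= y %/ a)%N by exact: leq_div2r.
have h2 : (y %/ a <= (x %/ a).+1)%N.
  by have := leq_div2r a (ltnW ltyx); rewrite divnDr // divnn a0 addn1.
case: (ltngtP (x %/ a) (y %/ a)) h1 h2 => // [lt1 _ le2|-> //].
have E : (y %/ a = (x %/ a).+1)%N by apply/eqP; rewrite eqn_leq le2 lt1.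
by move: ndv; rewrite E divnS // => /negbTE ->.
Qed.

Lemma dvdn_shift m b l : (b < m)%N -> (m %| l + (m - b))%N -> (l %% m = b)%N.
Proof.
move=> bm /dvdnP [q Eq].
have q0 : (0 < q)%N by case: q Eq => // /eqP; rewrite mul0n addn_eq0; lia.
have -> : (l = q.-1 * m + b)%N by case: q q0 Eq => // q _; rewrite mulSn /=; lia.
by rewrite modnMDl modn_small.
Qed.

(** Averaging: the [m] residue classes partition the total weight. *)
Lemma light_residue_class (T : finType) (w l : T -> nat) m : (0 < m)%N ->
  exists2 b, (b < m)%N & (m * \sum_(v | l v %% m == b) w v <= \sum_v w v)%N.
Proof.
case: m => // m _; set M := m.+1.
have E : (\sum_v w v = \sum_(b < M) \sum_(v | l v %% M == b) w v)%N.
  rewrite (partition_big (fun v => Ordinal (ltn_pmod (l v) (ltn0Sn m))) xpredT) //=.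
have [/existsP [b hb]|/existsPn h] := boolP [exists b : 'I_M,
    (M * \sum_(v | l v %% M == b) w v <= \sum_v w v)%N]; first by exists b.
have h1 : (\sum_(b < M) \sum_v w v < \sum_(b < M) M * \sum_(v | l v %% M == b) w v)%N.
  rewrite (bigD1 (ord0 : 'I_M)) //= [X in (_ < X)%N](bigD1 (ord0 : 'I_M)) //=.
  rewrite -addSn leq_add //; first by rewrite ltnNge; exact: (h ord0).
  by apply: leq_sum => b _; apply: ltnW; rewrite ltnNge; exact: h.
by move: h1; rewrite -big_distrr -E sum_nat_const card_ord ltnn.
Qed.

(** With m = 3N and a = 3ND + 1 this is m 2^(a m): a block spans [a * m] consecutive exponents, so
    2^(a m) bounds the ratio of weights in it. *)
Definition block_ratio (N D : nat) : nat :=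
  (3 * N * 2 ^ ((3 * N * D).+1 * (3 * N)))%N.

(* Deleting the vertices with a much heavier neighbour and one residue class of
   weight levels leaves components on which the weights agree up to the bounded
   factor [block_ratio]; there the unweighted hypothesis applies. *)
Lemma weighted_of_unweighted (T : finType) (e : rel T) (D N k : nat) :
  (0 < N)%N -> symmetric e -> (forall v, #|[set u | e v u]| <= D)%N ->
  (forall W : {set T}, exists2 X : {set T},
     (block_ratio N D * #|X| <= #|W|)%N & (cc (restrict e (W :\: X)) <= k)%N) ->
  forall c : T -> nat, exists2 X : {set T},
    (cc (restrict e (~: X)) <= k)%N &
    (N * \sum_(v in X) 2 ^ c v <= \sum_v 2 ^ c v)%N.
Proof.
move=> N0 es degD hW c; set a := ((3 * N * D).+1)%N; set m := (3 * N)%N.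
have a0 : (0 < a)%N by [].
have m0 : (0 < m)%N by rewrite muln_gt0.
set w := fun v => (2 ^ c v)%N.
pose X1 := [set v | [exists u, e v u && (c v + a <= c u)%N]].
(* Each vertex of [X1] is charged to a neighbour at least 2^a times heavier, and a vertex is charged
   at most [D] times; finally m D < a < 2^a. *)
have wX1 : (m * \sum_(v in X1) w v <= \sum_v w v)%N.
  have h : (2 ^ a * \sum_(v in X1) w v <= D * \sum_v w v)%N.
    rewrite !big_distrr /=.
    apply: (@leq_trans (\sum_v \sum_(u | e v u) w u)).
      rewrite [X in (_ <= X)%N](bigID (mem X1)) /=.
      apply: leq_trans (leq_addr _ _); apply: leq_sum => v.
      rewrite inE => /existsP [u /andP [evu le]].
      rewrite (bigD1 u) //=; apply: leq_trans (leq_addr _ _).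
      by rewrite /w -expnD leq_exp2l // addnC.
    rewrite (exchange_big_dep xpredT) //=; apply: leq_sum => u _.
    rewrite sum_nat_const leq_mul2r; apply/orP; right.
    apply: leq_trans (degD u); rewrite -cardsE eq_leq //; apply: eq_card => v.
    by rewrite !inE es.
  have [D0|D0] := posnP D.
    move: h; rewrite D0 mul0n leqn0 muln_eq0 expn_eq0 /= => /eqP ->.
    by rewrite muln0.
  rewrite -(leq_pmul2l D0); apply: leq_trans h.
  rewrite mulnA leq_mul2r; apply/orP; right.
  by rewrite mulnC ltnW //; apply: ltn_trans (ltn_expl a _).
have [b bm wX2'] := light_residue_class w (fun v => c v %/ a)%N m0.
(* The shift moves the light residue class to the multiples of [m], so that [X2] sits at the block
   boundaries. *)
pose c' v := (c v + a * (m - b))%N.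
pose X2 := [set v | m %| c' v %/ a]%N.
have wX2 : (m * \sum_(v in X2) w v <= \sum_v w v)%N.
  apply: leq_trans wX2'; rewrite leq_mul2l; apply/orP; right.
  rewrite big_mkcond [X in (_ <= X)%N]big_mkcond /=; apply: leq_sum => v _.
  rewrite inE; case: ifP => // dv; case: eqP => // -[]; apply: dvdn_shift => //.
  by move: dv; rewrite /c' addnC mulnC divnMDl // addnC.
pose j v := (c' v %/ (a * m))%N.
pose W i := [set v | j v == i].
have /choice [Xf hXf] : forall i, exists X : {set T},
    (block_ratio N D * #|X| <= #|W i|)%N /\ (cc (restrict e (W i :\: X)) <= k)%N.
  by move=> i; have [X] := hW (W i); exists X.
pose X3 := [set v | v \in Xf (j v)].
have wX3 : (m * \sum_(v in X3) w v <= \sum_v w v)%N.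
  (* Scaling by 2^(a(m-b)) turns the exponents [c] into [c'], which define the blocks. *)
  rewrite -(leq_pmul2r (m := (2 ^ (a * (m - b))))) ?expn_gt0 // -mulnA !big_distrl /=.
  have Ew v : (w v * 2 ^ (a * (m - b)) = 2 ^ c' v)%N by rewrite -expnD.
  rewrite (eq_bigr _ (fun v _ => Ew v)) [X in (_ <= X)%N](eq_bigr _ (fun v _ => Ew v)).
  set J := (\max_v j v).+1.
  have jJ v : (j v < J)%N by rewrite ltnS; apply: leq_bigmax.
  pose p v : 'I_J := Ordinal (jJ v).
  rewrite (partition_big p xpredT) //= [X in (_ <= X)%N](partition_big p xpredT) //=.
  rewrite big_distrr /=; apply: leq_sum => i _.
  have am0 : (0 < a * m)%N by rewrite muln_gt0 a0.
  (* In block [i] the exponents lie between a m i and a m i + a m: bound each deleted weight from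
     above and each weight of [W i] from below. *)
  apply: (@leq_trans (m * (#|Xf i| * 2 ^ (a * m * i + a * m)))).
    rewrite leq_mul2l; apply/orP; right; rewrite -sum_nat_const.
    rewrite big_mkcond [X in (_ <= X)%N]big_mkcond /=; apply: leq_sum => v _.
    case: ifP => // /andP []; rewrite inE => vX /eqP <- /=; rewrite vX leq_exp2l //.
    by rewrite addnC -mulnS mulnC ltnW // ltn_ceil.
  apply: (@leq_trans (#|W i| * 2 ^ (a * m * i))).
    have [h _] := hXf i; rewrite expnD.
    apply: leq_trans (leq_mul h (leqnn _)).
    by rewrite /block_ratio -/a -/m eq_leq //; ring.
  rewrite -sum_nat_const big_mkcond [X in (_ <= X)%N]big_mkcond /=.
  apply: leq_sum => v _; rewrite inE -(inj_eq val_inj) /=.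
  by case: eqP => // <-; rewrite leq_exp2l // mulnC; exact: leq_divM.
exists (X1 :|: X2 :|: X3); last first.
  have hU : (\sum_(v in X1 :|: X2 :|: X3) w v <= \sum_(v in X1) w v +
      \sum_(v in X2) w v + \sum_(v in X3) w v)%N.
    have S (A : {set T}) : (\sum_(v in A) w v = \sum_v (v \in A) * w v)%N.
      by rewrite big_mkcond; apply: eq_bigr => v _; case: (v \in A); rewrite ?mul1n ?mul0n.
    rewrite !S -!big_split /=; apply: leq_sum => v _.
    rewrite -!mulnDl leq_mul2r !in_setU; apply/orP; right.
    by case: (v \in X1); case: (v \in X2); case: (v \in X3).
  rewrite -/(w _); move: hU wX1 wX2 wX3; rewrite /m.
  rewrite -[X in _ -> _ -> _ -> _ -> (N * X <= _)%N]/(\sum_(v in X1 :|: X2 :|: X3) w v)%N.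
  rewrite -[X in _ -> _ -> _ -> _ -> (_ <= X)%N]/(\sum_v w v)%N.
  nia.
apply/cc_leP => v; have [_ /cc_leP h] := hXf (j v); apply: leq_trans (h v).
apply/subset_leq_card/subsetP => u; rewrite !inE => /connectP [p pp ->].
(* The block is constant along a path: [X1] rules out jumps by [a] or more, and [X2] rules out
   crossing a boundary by a smaller step. *)
suff key : forall x, path (restrict e (~: (X1 :|: X2 :|: X3))) x p -> j x = j v ->
    connect (restrict e (W (j v) :\: Xf (j v))) x (last x p) by exact: key.
elim: p {pp} => [|y p IH] x /=; first by rewrite connect0.
case/andP=> /and3P [exy]; rewrite 2!in_setC 4!in_setU !negb_or => /andP [/andP [x1 x2] x3].
case/andP=> /andP [y1 y2] y3 pp jx.
have jxy : j x = j y.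
  rewrite /j; have [le|/ltnW le] := leqP (c' x) (c' y).
    apply: eq_block_of_close => //; last by rewrite inE in y2.
    rewrite ltnNge; apply: contra x1 => h1; rewrite inE; apply/existsP; exists y.
    by rewrite exy /=; move: h1; rewrite /c'; lia.
  apply/esym/eq_block_of_close => //; last by rewrite inE in x2.
  rewrite ltnNge; apply: contra y1 => h1; rewrite inE; apply/existsP; exists x.
  by rewrite es exy /=; move: h1; rewrite /c'; lia.
apply: connect_trans (IH y pp _); last by rewrite -jxy.
apply: connect1; rewrite /restrict /= exy !inE -jxy jx eqxx !andbT.
by move: x3 y3; rewrite !inE -jxy jx => -> ->.
Qed.

(** * Separators from tree decompositions *)

Lemma connect_closed (T : finType) (e e' : rel T) (K : {set T}) u v :
  (forall x y, x \in K -> e x y -> e' x y /\ y \in K) ->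
  u \in K -> connect e u v -> connect e' u v /\ v \in K.
Proof.
move=> h uK /connectP [p]; elim: p u uK => [|x p IH] u uK /=.
  by move=> _ ->; rewrite connect0.
case/andP=> eux px lx; have [e'ux xK] := h u x uK eux.
have [c vK] := IH x xK px lx; split=> //.
exact: connect_trans (connect1 e'ux) c.
Qed.

Lemma component_isolated (T : finType) (e : rel T) v :
  (forall u, ~~ e v u) -> [set u | connect e v u] = [set v].
Proof.
move=> h; apply/setP => u; rewrite !inE; apply/idP/eqP => [|->]; last exact: connect0.
by case/connectP=> [[|x p]] //= /andP [evx]; move: (h x); rewrite evx.
Qed.

Section RootedTree.
Variables (m : nat) (t : rel 'I_m).
Hypothesis tree_t : is_tree t.

Let t_sym : symmetric t. Proof. by case: tree_t. Qed.
Let t_irr : irreflexive t. Proof. by case: tree_t. Qed.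

(** A simple path from [a] to [b] avoiding the edge would close up with it to a cycle. *)
Lemma tree_edge_bridge a b : t a b ->
  ~~ connect [rel x y | t x y && ~~ ((x == a) && (y == b) || (x == b) && (y == a))] a b.
Proof.
move=> tab; apply/negP => /connectP [p0 pp0 lp0].
case: (shortenP pp0) lp0 => p pp up _ lp.
case: tree_t => _ _ _ _ /(_ (a :: p)) /negP; apply.
rewrite up /=; apply/andP; split.
  (* A path of length at most one would force [a = b] or use the removed edge, so the cycle has at
     least three nodes. *)
  case: p pp up lp => [|x [|y p]] //=.
    by move=> _ _ E; move: tab; rewrite E t_irr.
  by rewrite andbT => /andP [_] /negP nx _ E; case: nx; rewrite E !eqxx.
rewrite rcons_path -lp t_sym tab andbT.
by apply: sub_path pp => x y /= /andP [].
Qed.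

(** [d] is the distance from the root and [par] picks a neighbour closer to it. An edge that [par]
    uses in neither direction could be bypassed through the root, so it would not be a bridge. *)
Lemma tree_parent : exists (rt : 'I_m) (par : 'I_m -> 'I_m) (d : 'I_m -> nat),
  [/\ par rt = rt, forall i, i != rt -> (d (par i) < d i)%N &
      forall i j, t i j -> par i = j \/ par j = i].
Proof.
have [m0 _ _ t_conn _] := tree_t; pose rt := Ordinal m0.
pose P i n := [exists p : n.-tuple 'I_m, path t rt p && (last rt p == i)].
have exP i : exists n, P i n.
  have /connectP [p pp ->] := t_conn rt i.
  by exists (size p); apply/existsP; exists (in_tuple p); rewrite /= pp eqxx.
pose d i := ex_minn (exP i).
have d_rt : d rt = 0%N.
  apply/eqP; rewrite -leqn0 /d; case: ex_minnP => n _; apply.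
  by apply/existsP; exists [tuple]; rewrite /= eqxx.
have step i : i != rt -> exists j, t i j && (d j < d i)%N.
  move=> irt; rewrite {2}/d; case: ex_minnP => n /existsP [p /andP [pp /eqP lp]] _.
  case/lastP: (val p) (size_tuple p) pp lp => [|q x].
    by move=> _ _ E; move: irt; rewrite -E eqxx.
  rewrite size_rcons rcons_path last_rcons => E /andP [pq tx] Ex.
  exists (last rt q); rewrite t_sym -Ex tx -E ltnS /d; case: ex_minnP => k _; apply.
  by apply/existsP; exists (in_tuple q); rewrite /= pq eqxx.
(* By the default the root, which has no neighbour of smaller depth, is its own parent. *)
pose par i := odflt i [pick j | t i j && (d j < d i)%N].
have parP i : i != rt -> t i (par i) && (d (par i) < d i)%N.
  move=> /step [j hj]; rewrite /par; case: pickP => [x //|/(_ j)].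
  by rewrite hj.
exists rt, par, d; split.
- by rewrite /par; case: pickP => // x; rewrite d_rt ltn0 andbF.
- by move=> i /parP /andP [].
move=> a b tab; have [|nab] := eqVneq (par a) b; first by left.
have [|nba] := eqVneq (par b) a; [by right | exfalso].
have /negP := tree_edge_bridge tab; set t' := (X in connect X); case.
have t'_sym : symmetric t'.
  by move=> x y; rewrite /t' /= t_sym; congr (_ && ~~ _); rewrite orbC ![(y == _) && _]andbC.
have toroot i : connect t' i rt.
  have [n] := ubnP (d i); elim: n i => // n IH i; rewrite ltnS => le.
  have [-> //|irt] := eqVneq i rt.
  have /andP [ti di] := parP i irt.
  apply: connect_trans (IH (par i) (leq_trans di le)); apply: connect1.
  rewrite /t' /= ti /=; apply/negP => /orP [] /andP [/eqP E /eqP E'].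
    by move: nab; rewrite -E E' eqxx.
  by move: nba; rewrite -E E' eqxx.
apply: connect_trans (toroot a) _; rewrite (sym_connect_sym t'_sym); exact: toroot.
Qed.

End RootedTree.

Section Separator.
Variables (T : finType) (e : rel T) (m : nat) (t : rel 'I_m).
Variables (B : 'I_m -> {set T}) (S : {set T}) (w s : nat).
Hypotheses (s_gt0 : (0 < s)%N) (tree_t : is_tree t).
(** Only [S] has to be covered: in the application it is the complement of a deleted set, seen
    inside the full vertex type. *)
Hypothesis covV : {in S, forall v, exists i, v \in B i}.
Hypothesis covE : {in S &, forall u v, e u v -> exists i, (u \in B i) && (v \in B i)}.
Hypothesis conn : forall v i j, v \in B i -> v \in B j ->
  connect [rel a b | [&& t a b, v \in B a & v \in B b]] i j.
Hypothesis width : forall i, (#|B i| <= w.+1)%N.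

(* Repeatedly cut off, by deleting the bag of a lowest possible node, the more
   than [s] vertices that only occur below that node. *)
Lemma tree_decomposition_separator (W : {set T}) : W \subset S ->
  exists2 X : {set T}, (s * #|X| <= w.+1 * #|W|)%N &
    (cc (restrict e (W :\: X)) <= s)%N.
Proof.
have [rt [par [d [par_rt d_par edge_par]]]] := tree_parent tree_t.
(* [fconnect par i x] says that [i] is in the subtree at [x], which a walk in the tree can leave
   only along the edge from [x] to its parent. *)
have cross x i j v : fconnect par i x -> ~~ fconnect par j x ->
    v \in B i -> v \in B j -> (v \in B x) && (v \in B (par x)).
  move=> ix jx vi vj; have /connectP [p pp lp] := conn vi vj.
  elim: p i ix {vi} pp lp => [|y p IH] i ix /=; first by move=> _ E; rewrite E ix in jx.
  case/andP => /and3P [tiy vi vy] pp lp.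
  have [yx|yx] := boolP (fconnect par y x); first exact: IH yx pp lp.
  have {}tiy := edge_par _ _ tiy; case: tiy => E; last first.
    by case/negP: yx; apply: connect_trans ix; apply: connect1; rewrite /= E.
  have [Eix|nix] := eqVneq i x; first by rewrite -Eix vi E vy.
  case/negP: yx; case/connectP: ix nix => [[|z q]] /=; first by move=> _ ->; rewrite eqxx.
  by rewrite E => /andP [/eqP -> pq] lq _; apply/connectP; exists q.
have child x i : fconnect par i x -> i != x ->
    exists c, [/\ c != x, par c = x & fconnect par i c].
  move=> /iter_findex; move: (findex _ _ _) => n; elim: n i => [|n IH] i /=.
    by move=> ->; rewrite eqxx.
  rewrite -iterS iterSr => h ix; have [E|ne] := eqVneq (par i) x; first by exists i.
  have [c [cx pc ic]] := IH _ h ne; exists c; split=> //.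
  by apply: connect_trans ic; apply: connect1; rewrite /= eqxx.
have to_rt i : fconnect par i rt.
  have [n] := ubnP (d i); elim: n i => // n IH i; rewrite ltnS => le.
  have [-> //|irt] := eqVneq i rt.
  apply: connect_trans (IH (par i) (leq_trans (d_par _ irt) le)).
  by apply: connect1; rewrite /= eqxx.
pose D (W : {set T}) x := [set v in W | [forall i, (v \in B i) ==> fconnect par i x]].
have DP U x v i : v \in D U x -> v \in B i -> fconnect par i x.
  by rewrite inE => /andP [_ /forallP /(_ i) /implyP].
have notD (U : {set T}) x v : v \in U -> v \notin D U x ->
    exists2 i, v \in B i & ~~ fconnect par i x.
  move=> vU; rewrite inE vU /= negb_forall => /existsP [i].
  by rewrite negb_imply => /andP []; exists i.
(* Some bag of the subtree contains both ends of the edge, and its outer end [u] also has a bag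
   outside, so [cross] applies to [u]. *)
have exitD (U : {set T}) x u v : U \subset S -> u \in U -> v \in U -> e u v || e v u ->
    v \in D U x -> u \notin D U x -> (u \in B x) && (u \in B (par x)).
  move=> US uU vU euv vD /(notD _ _ _ uU) [j uj nj].
  have [i /andP [ui vi]] : exists i, (u \in B i) && (v \in B i).
    have [uS vS] := (subsetP US _ uU, subsetP US _ vU).
    case/orP: euv => [/(covE uS vS) //|/(covE vS uS) [i hi]].
    by exists i; rewrite andbC.
  exact: cross (DP _ _ _ _ vD vi) nj ui uj.
have [n] := ubnP #|W|; elim: n W => // n IH W; rewrite ltnS => leWn WS.
have isolated (X : {set T}) v : v \notin W :\: X ->
    (#|[set u | connect (restrict e (W :\: X)) v u]| <= s)%N.
  move=> vW; rewrite component_isolated ?cards1 // => u.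
  by rewrite /restrict /= (negbTE vW) andbF.
have [leWs|ltsW] := leqP #|W| s.
  exists set0; first by rewrite cards0 muln0.
  apply/cc_leP => v; have [vW|/isolated //] := boolP (v \in W :\: set0).
  apply: leq_trans leWs; apply/subset_leq_card/subsetP => u; rewrite inE => c.
  have [] := @connect_closed T _ (restrict e (W :\: set0)) (W :\: set0) v u _ vW c.
    by move=> x y _ h; split=> //; case/and3P: h.
  by rewrite setD0.
have Drt : (s < #|D W rt|)%N.
  apply: leq_trans ltsW _; apply/subset_leq_card/subsetP => v vW.
  by rewrite inE vW; apply/forallP => i; rewrite to_rt implybT.
(* For a deepest such [x], every child has at most [s] vertices of this kind; the bag of [x] is paid
   for by the more than [s] vertices of [D W x], which leave [W]. *)
case: (@arg_maxnP _ rt (fun x => s < #|D W x|)%N d Drt) => x Dx xmax.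
pose W' := W :\: (D W x :|: B x).
have DW : D W x \subset W by apply/subsetP => v; rewrite inE => /andP [].
have cW' : (#|W'| + #|D W x| <= #|W|)%N.
  rewrite -(cardsID (D W x) W) (setIidPr DW) addnC leq_add2l.
  by apply/subset_leq_card/setDS/subsetUl.
have [|| X' cX' /cc_leP ccX'] := IH W'.
- by apply: leq_trans leWn; lia.
- by apply: subset_trans WS; exact: subsetDl.
exists (X' :|: B x).
  have h1 : (#|X' :|: B x| <= #|X'| + #|B x|)%N by rewrite cardsU leq_subr.
  apply: leq_trans (leq_mul (leqnn s) h1) _; rewrite mulnDr.
  apply: leq_trans (leq_mul (leqnn _) cW'); rewrite mulnDr leq_add // mulnC.
  by apply: leq_mul (width x) (ltnW Dx).
apply/cc_leP => v; have [vW|/isolated //] := boolP (v \in W :\: (X' :|: B x)).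
have {}vW : [/\ v \in W, v \notin X' & v \notin B x].
  by move: vW; rewrite !inE negb_or -andbA => /and3P [].
(* As [v] is not in the bag of [x], its bags all lie below one child [c] of [x], and its component
   stays inside [D W c]. *)
case: vW => vW vX' vB; have [vD|vD] := boolP (v \in D W x).
  have [i vi] := covV (subsetP WS _ vW).
  have ix := DP _ _ _ _ vD vi.
  have nix : i != x by apply: contraNneq vB => <-.
  have [c [cx pc ic]] := child _ _ ix nix.
  have vDc : v \in D W c.
    apply/negPn/negP => /(notD _ _ _ vW) [j vj nj].
    by have := cross _ _ _ _ ic nj vi vj; rewrite pc (negbTE vB) andbF.
  have Dc : (#|D W c| <= s)%N.
    rewrite leqNgt; apply/negP => /xmax; rewrite /= -pc; apply/negP; rewrite -ltnNge.
    by apply: d_par; apply: contraNneq cx => E; rewrite -pc E par_rt.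
  apply: leq_trans Dc; apply/subset_leq_card/subsetP => u; rewrite inE => cvu.
  have [] // := @connect_closed T _ (restrict e (W :\: (X' :|: B x))) (D W c) v u _ vDc cvu.
  move=> y z yD eyz; split=> //; case/and3P: eyz => eyz.
  rewrite !in_setD !in_setU !negb_or => /andP [/andP [yX' yB] yW] /andP [/andP [zX' zB] zW].
  apply/negPn/negP => zD; have := exitD W c z y WS zW yW.
  by rewrite eyz orbT yD zD pc (negbTE zB) andbF => /(_ isT isT isT).
(* The component of such a [v] never enters [D W x], so it stays in [W'] and induction bounds it. *)
have vW' : v \in W' by rewrite in_setD in_setU (negbTE vD) (negbTE vB) vW.
apply: leq_trans (ccX' v); apply/subset_leq_card/subsetP => u; rewrite inE => cvu; rewrite inE.
have [] // := @connect_closed T _ (restrict e (W' :\: X')) W' v u _ vW' cvu.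
move=> y z yW' eyz; case/and3P: (eyz) => eyz'.
rewrite !in_setD !in_setU !negb_or => /andP [/andP [yX' yB] yW] /andP [/andP [zX' zB] zW].
have yD : y \notin D W x by move: yW'; rewrite !in_setD in_setU negb_or => /andP [/andP []].
have zD : z \notin D W x.
  apply/negP => zD; have := exitD W x y z WS yW zW.
  by rewrite eyz' zD yD (negbTE yB) => /(_ isT isT isT).
by rewrite /restrict /= eyz' !in_setD !in_setU !negb_or yX' yB yW yD zX' zB zW zD.
Qed.

End Separator.

(** The components serve as bags on the nodes of a star. Each vertex is in exactly one bag, and the
    extra node keeps the tree nonempty when [T] is empty. *)
Lemma tw_le_cc (T : finType) (e : rel T) : symmetric e -> (tw e <= cc e)%N.
Proof.
move=> es; have cs := sym_connect_sym es.
rewrite /tw; case: ex_minnP => w _; apply; apply/asboolP.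
pose t : rel 'I_(#|T|.+1) := [rel i j | (i == ord0) != (j == ord0)].
pose B (i : 'I_(#|T|.+1)) := [set v : T | val (enum_rank (fingraph.root e v)) == val i].
have inB v : v \in B (widen_ord (leqnSn _) (enum_rank (fingraph.root e v))) by rewrite inE.
have BP v i : v \in B i -> i = widen_ord (leqnSn _) (enum_rank (fingraph.root e v)).
  by rewrite inE => /eqP E; apply/val_inj; rewrite -E.
exists (#|T|).+1, t, B; split.
- split=> //.
  + by move=> i j; rewrite /t /= eq_sym.
  + by move=> i; rewrite /t /= eqxx.
  + have c0 i : connect t ord0 i.
      have [-> //|ne] := eqVneq i ord0; apply: connect1; rewrite /t /= eqxx.
      by rewrite (negbTE ne).
    have ts : symmetric t by move=> i j; rewrite /t /= eq_sym.
    by move=> i j; apply: connect_trans (c0 j); rewrite (sym_connect_sym ts).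
  (* Every edge has exactly one end at the centre [ord0], so a longer cycle would repeat the centre
     or join two leaves. *)
  + case=> [|a [|b [|c p]]]; rewrite ?andbF //; apply/negP => /and3P [us _].
    rewrite /= => /and3P [tab tbc]; move: us; rewrite /= !inE !negb_or.
    case/and3P=> /and3P [ab ac ap] /andP [bc bp] _.
    move: tab tbc; rewrite /t /=.
    case: (eqVneq b ord0) => [b0|nb]; last first.
      case: (eqVneq a ord0) => // a0 _; case: (eqVneq c ord0) => // c0.
      by rewrite a0 c0 eqxx in ac.
    case: (eqVneq a ord0) => // na _; case: (eqVneq c ord0) => // nc _.
    case: p ap bp => [|x p] /= ap; first by rewrite (negbTE na) (negbTE nc).
    rewrite inE negb_or => /andP [bx _].
    by rewrite (negbTE nc); case: (eqVneq x ord0) => // x0; rewrite b0 x0 eqxx in bx.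
- by move=> v; eexists; exact: inB.
- move=> u v euv; exists (widen_ord (leqnSn _) (enum_rank (fingraph.root e u))).
  rewrite inB inE /=.
  suff -> : fingraph.root e u = fingraph.root e v by [].
  by apply/eqP; rewrite root_connect // connect1.
- by move=> v i j /BP -> /BP ->; exact: connect0.
move=> i; apply: leqW; have [E|[v vi]] := set_0Vmem (B i); first by rewrite E cards0.
apply: leq_trans (leq_bigmax v); apply/subset_leq_card/subsetP => u ui.
rewrite inE -root_connect //; apply/eqP/enum_rank_inj/val_inj.
by move: ui vi; rewrite !inE => /eqP -> /eqP ->.
Qed.

(** * Graph classes *)

Definition vertex_separable (C : graph_class) : Prop :=
  forall N, (0 < N)%N -> exists k, forall G, C G ->
    forall W : {set 'I_(gn G)}, exists2 X : {set 'I_(gn G)},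
      (N * #|X| <= #|W|)%N & (cc (restrict (@gadj G) (W :\: X)) <= k)%N.

(** A thin distribution as a list with repetitions, uniform over its entries: its probabilities are
    rational, as the values of structures must be. *)
Definition uniformly_fragile (C : graph_class) : Prop :=
  forall N, (0 < N)%N -> exists k, forall G, C G ->
    exists Xs : seq {set 'I_(gn G)}, [/\ (0 < size Xs)%N,
      forall X, X \in Xs -> (cc (restrict (@gadj G) (~: X)) <= k)%N &
      forall v, (N * count (fun X : {set 'I_(gn G)} => v \in X) Xs <= size Xs)%N].

Lemma separable_fragile C :
  bounded_degree C -> vertex_separable C -> uniformly_fragile C.
Proof.
move=> [D hD] hs N N0.
(* One factor 2 is demanded by the hypothesis of [uniform_cover], the other makes up for the 2 in
   its conclusion. *)
have [|k hk] := hs (block_ratio (2 * (2 * N)) D).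
  by rewrite !muln_gt0 expn_gt0 N0.
exists k => G CG.
have N4 : (0 < 2 * (2 * N))%N by rewrite !muln_gt0.
have N2 : (0 < 2 * N)%N by rewrite !muln_gt0.
have [Xs [s0 hX hc]] := uniform_cover N2
  (weighted_of_unweighted N4 (@gsym G) (hD G CG) (hk G CG)).
by exists Xs; split=> // v; have := hc v; rewrite -mulnA leq_pmul2l.
Qed.

(** * Bounded degree and separators from hyperfiniteness *)

Lemma natr_le_invM (N n m : nat) : (0 < N)%N ->
  (n%:R <= N%:R^-1 * m%:R :> R)%R = (N * n <= m)%N.
Proof. by move=> N0; rewrite mulrC ler_pdivlMr ?ltr0n // -natrM ler_nat mulnC. Qed.

Lemma hyperfinite_nat C N : hyperfinite C -> (0 < N)%N ->
  exists k, forall G, C G -> exists F : {set 'I_(gn G) * 'I_(gn G)},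
    [/\ F \subset edges G, (N * #|F| <= #|edges G|)%N & (cc (del_edges F) <= k)%N].
Proof.
move=> hC N0; have [|k hk] := hC (N%:R^-1)%R; first by rewrite invr_gt0 ltr0n.
by exists k => G /hk [F [h1 h2 h3]]; exists F; rewrite -natr_le_invM.
Qed.

(** At most half of the edges of the star at [v] are deleted, and the others end in the component of
    [v], so deg v <= k + deg v / 2. *)
Lemma hyperfinite_bounded_degree C : monotone C -> hyperfinite C -> bounded_degree C.
Proof.
move=> monC hC; have [k hk] := hyperfinite_nat hC (isT : 0 < 2)%N.
exists (2 * k)%N => G CG v.
pose adj : rel 'I_(gn G) := [rel x y | gadj x y && ((x == v) || (y == v))].
have adj_sym : symmetric adj by move=> x y; rewrite /adj /= gsym orbC.
have adj_irr : irreflexive adj by move=> x; rewrite /adj /= girr.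
pose H := Graph adj_sym adj_irr.
have CH : C H.
  apply: monC CG _; exists id; split=> // x y.
  by rewrite /adj /= => /andP [].
have [F [FE cF /cc_leP/(_ v) ccF]] := hk H CH.
pose other (p : 'I_(gn G) * 'I_(gn G)) := if p.1 == v then p.2 else p.1.
have cE : (#|edges H| <= deg v)%N.
  rewrite -(@card_in_imset _ _ other).
    apply/subset_leq_card/subsetP => u /imsetP [[x y]]; rewrite !inE /= /adj /other /=.
    case: (eqVneq x v) => [->|_] /= /and3P [_ h]; first by move=> _ ->.
    by move=> /eqP E ->; rewrite -E gsym.
  move=> [x y] [x' y']; rewrite !inE /= /adj /other /=.
  case: (eqVneq x v) => [->|nx]; case: (eqVneq x' v) => [->|nx'] //=.
  - by move=> _ _ ->.
  - move=> /and3P [lt1 _ _] /and3P [lt2 _ /eqP E] E'.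
    by move: lt1 lt2; rewrite E' E; lia.
  - move=> /and3P [lt1 _ /eqP E] /and3P [lt2 _ _] E'.
    by move: lt1 lt2; rewrite -E' E; lia.
  by move=> /and3P [_ _ /eqP ->] /and3P [_ _ /eqP ->] ->.
have dF : (deg v <= k + #|F|)%N.
  pose K := [set u | connect (@del_edges H F) v u].
  pose L := [set u in [set u | gadj v u] | u \notin K].
  have h1 : (deg v <= #|K| + #|L|)%N.
    rewrite /deg -(cardsID K [set u | gadj v u]); apply: leq_add.
      by apply/subset_leq_card/subsetIr.
    by apply/subset_leq_card/subsetP => u; rewrite !inE andbC.
  apply: leq_trans h1 (leq_add ccF _).
  (* A neighbour outside the component of [v] is charged to its edge to [v], which must be in [F];
     edges are stored with the smaller end first. *)
  rewrite -(@card_in_imset _ _ (fun u : 'I_(gn G) => if (v < u)%N then (v, u) else (u, v))).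
    apply/subset_leq_card/subsetP => p /imsetP [u].
    rewrite !inE => /andP [avu nc] ->.
    have : ~~ @del_edges H F v u by apply: contra nc; exact: connect1.
    rewrite /del_edges /= /adj /= avu eqxx /= negb_and !negbK.
    have nF x y : (x, y) \in F -> (x < y)%N.
      by move/(subsetP FE); rewrite inE => /andP [].
    case: ltnP => h /orP [] // /nF h'.
      by have := ltn_trans h h'; rewrite ltnn.
    by have := leq_ltn_trans h h'; rewrite ltnn.
  move=> u u'; rewrite !inE => /andP [avu _] /andP [avu' _].
  by case: ltnP => h; case: ltnP => h' [] // E1 E2; rewrite ?E1 ?E2 // -?E1 -?E2.
by lia.
Qed.

(** The graph induced on [W] has at most D |W| edges; delete one end of each edge of its cut. Using
    [D.+1] covers [D = 0]. *)
Lemma hyperfinite_separable C :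
  monotone C -> bounded_degree C -> hyperfinite C -> vertex_separable C.
Proof.
move=> monC [D hD] hC N N0.
have [|k hk] := hyperfinite_nat (N := N * D.+1) hC; first by rewrite muln_gt0 N0.
exists k => G CG W.
have adj_sym : symmetric (restrict (@gadj G) W).
  by move=> x y; rewrite /restrict /= gsym andbCA andbC -!andbA; do !bool_congr.
have adj_irr : irreflexive (restrict (@gadj G) W) by move=> x; rewrite /restrict /= girr.
pose H := Graph adj_sym adj_irr.
have CH : C H by apply: monC CG _; exists id; split=> // x y /and3P [].
have [F [FE cF ccF]] := hk H CH.
have cE : (#|edges H| <= #|W| * D)%N.
  apply: (@leq_trans (\sum_(u in W) deg u)); last first.
    by rewrite -sum_nat_const; apply: leq_sum => u _; exact: hD.
  apply: (@leq_trans #|[set p : 'I_(gn G) * 'I_(gn G) | (p.1 \in W) && gadj p.1 p.2]|).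
    by apply/subset_leq_card/subsetP => p; rewrite !inE => /andP [_ /and3P [-> -> _]].
  rewrite -sum1_card (partition_big fst (mem W)) /=; last by move=> p; rewrite inE => /andP [].
  apply: leq_sum => u uW; rewrite sum1_card /deg.
  apply: leq_trans (leq_imset_card (fun x => (u, x)) (mem [set x | gadj u x])).
  apply/subset_leq_card/subsetP => -[x y]; rewrite unfold_in /= inE /=.
  move=> /andP [/andP [_ h] /eqP E].
  by apply/imsetP; exists y; rewrite ?inE -?E.
exists [set p.1 | p in F].
  have cX := leq_imset_card (fun p : 'I_(gn G) * 'I_(gn G) => p.1) (mem F).
  have : (N * D.+1 * #|[set p.1 | p in F]| <= D.+1 * #|W|)%N.
    apply: leq_trans (leq_mul (leqnn _) cX) (leq_trans cF (leq_trans cE _)).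
    by rewrite mulnC leq_mul2r leqnSn orbT.
  by rewrite -mulnA mulnCA leq_pmul2l.
apply: sub_cc ccF => x y; rewrite /del_edges /= /restrict /= !inE.
case/and3P => -> /andP [xF ->] /andP [yF ->] /=.
by apply/andP; split; [apply: contra xF|apply: contra yF] => h; apply/imsetP; eexists; eauto.
Qed.

(** * Thin distributions and uniform families *)

Lemma connect_homo (T T' : finType) (e : rel T) (e' : rel T') (f : T -> T') u v :
  (forall x y, e x y -> e' (f x) (f y)) -> connect e u v -> connect e' (f u) (f v).
Proof.
move=> h /connectP [p]; elim: p u => [|x p IH] u /=; first by move=> _ ->.
by case/andP=> /h/connect1 c /IH hp /hp; exact: connect_trans.
Qed.

Lemma cc_del_vertices (G : graph) (X : {set 'I_(gn G)}) k :
  (cc (restrict (@gadj G) (~: X)) <= k)%N -> (cc (@del_vertices G X) <= k)%N.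
Proof.
move=> /cc_leP h; apply/cc_leP => v; apply: leq_trans (h (val v)).
rewrite -(card_imset _ (val_inj : injective (val : del_vertices_type X -> _))).
apply/subset_leq_card/subsetP => u /imsetP [u']; rewrite !inE => c ->.
apply: connect_homo c => x y exy.
by rewrite /restrict /= !inE (valP x) (valP y) !andbT; exact: exy.
Qed.

(** The successor accounts for the vertices of [X], which [restrict] keeps as isolated vertices, in
    case [k = 0]. *)
Lemma cc_restrict_setC (G : graph) (X : {set 'I_(gn G)}) k :
  (cc (@del_vertices G X) <= k)%N -> (cc (restrict (@gadj G) (~: X)) <= k.+1)%N.
Proof.
move=> /cc_leP h; apply/cc_leP => v.
have [vX|vX] := boolP (v \in X).
  rewrite component_isolated ?cards1 // => u.
  by rewrite /restrict /= in_setC vX andbF.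
pose v' : del_vertices_type X := Sub v vX.
apply: (leq_trans _ (leqW (h v'))).
rewrite -(card_imset _ (val_inj : injective (val : del_vertices_type X -> _))).
apply/subset_leq_card/subsetP => u; rewrite inE => /connectP [p].
suff key : forall x : del_vertices_type X, path (restrict (@gadj G) (~: X)) (val x) p ->
    exists2 y : del_vertices_type X, val y = last (val x) p &
      connect (@del_vertices G X) x y.
  move=> pp ->; have [y <- c] := key v' pp; apply/imsetP; exists y => //.
  by rewrite inE.
elim: p => [|y p IH] x /=; first by exists x.
case/andP=> /and3P [exy _]; rewrite in_setC => yX.
pose y' : del_vertices_type X := Sub y yX.
move=> pp; have [z Ez c] := IH y' pp; exists z => //.
exact: connect_trans (connect1 (exy : del_vertices x y')) c.
Qed.

Lemma sum_count_mem (T : finType) (P : pred T) (s : seq T) :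
  (\sum_(x | P x) count_mem x s = count P s)%N.
Proof.
elim: s => [|y s IH] /=; first by rewrite big1.
rewrite big_split /= IH; congr (_ + _)%N; rewrite big_mkcond (bigD1 y) //= eqxx.
rewrite big1 ?addn0 => [|x /negbTE]; first by case: (P y).
by rewrite eq_sym => ->; case: (P x).
Qed.

Lemma uniformly_fragile_cc C : uniformly_fragile C -> fractionally_fragile cc C.
Proof.
move=> hC eps eps0; pose N := (Num.truncn eps^-1).+1.
have hN : (N%:R^-1 <= eps :> R)%R.
  rewrite -[leRHS]invrK lef_pV2 ?posrE ?invr_gt0 ?ltr0n // ltW //.
  by rewrite /N truncnS_gt.
have [k hk] := hC N isT; exists k => G CG.
have [Xs [s0 hX hc]] := hk G CG.
have s0' : (0 < (size Xs)%:R :> R)%R by rewrite ltr0n.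
pose pi : {ffun {set 'I_(gn G)} -> R} :=
  [ffun X => (count_mem X Xs)%:R / (size Xs)%:R]%R.
have sumpi P : (\sum_(X | P X) pi X = (count P Xs)%:R / (size Xs)%:R)%R.
  under eq_bigr => X _ do rewrite ffunE.
  by rewrite -mulr_suml -natr_sum sum_count_mem.
exists pi; split.
- split=> [X|]; first by rewrite ffunE divr_ge0.
  by rewrite sumpi count_predT divff // gt_eqF.
- move=> v; rewrite sumpi; apply: le_trans hN.
  by rewrite ler_pdivrMr // natr_le_invM.
move=> X; rewrite ffunE => h; apply/cc_del_vertices/hX.
rewrite -has_pred1 has_count -(ltr0n R).
by move: h; rewrite pmulr_lgt0 // invr_gt0.
Qed.

(** By thinness the expected weight of a random set is at most 1/N of the total, so some set of
    positive probability is no heavier. *)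
Lemma light_set n (pi : {ffun {set 'I_n} -> R}) (N : nat) (w : 'I_n -> nat) :
  (0 < N)%N -> is_distribution pi -> thin (N%:R^-1)%R pi ->
  exists2 X, (0 < pi X)%R & (N * \sum_(v in X) w v <= \sum_v w v)%N.
Proof.
move=> N0 [pi0 pi1] tpi.
have [/existsP [X /andP [h1 h2]]|/existsPn h] := boolP [exists X,
   (0 < pi X)%R && (N * \sum_(v in X) w v <= \sum_v w v)%N]; first by exists X.
exfalso.
have E : (\sum_X pi X * (\sum_(v in X) w v)%:R =
          \sum_v (w v)%:R * \sum_(X : {set 'I_n} | v \in X) pi X)%R.
  under eq_bigr => X _ do rewrite natr_sum big_distrr /=.
  rewrite (exchange_big_dep xpredT) //=; apply: eq_bigr => v _.
  by rewrite big_distrr /=; apply: eq_bigr => X _; rewrite mulrC.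
have up : (\sum_X pi X * (\sum_(v in X) w v)%:R <= N%:R^-1 * (\sum_v w v)%:R)%R.
  rewrite E natr_sum mulrC mulr_suml; apply: ler_sum => v _.
  by rewrite ler_wpM2l.
have [X0 X0p] : exists X, (0 < pi X)%R.
  apply/existsP; apply: contraT => /existsPn hn.
  have : (\sum_X pi X = 0 :> R)%R.
    by apply: big1 => X _; apply/eqP; rewrite eq_le pi0 leNgt hn.
  by rewrite pi1 => /eqP; rewrite oner_eq0.
have le X : (pi X * (N%:R^-1 * (\sum_v w v)%:R) <= pi X * (\sum_(v in X) w v)%:R)%R.
  have [h0|h0] := ltP 0%R (pi X); last first.
    have -> : pi X = 0%R by apply/eqP; rewrite eq_le pi0 h0.
    by rewrite !mul0r.
  rewrite ler_pM2l // mulrC ler_pdivrMr ?ltr0n // -natrM ler_nat mulnC ltnW //.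
  by move: (h X); rewrite h0 /= -ltnNge.
have : (N%:R^-1 * (\sum_v w v)%:R < \sum_X pi X * (\sum_(v in X) w v)%:R)%R.
  rewrite -[ltLHS]mul1r -[X in (X * _ < _)%R]pi1 mulr_suml (bigD1 X0) //= [ltRHS](bigD1 X0) //=.
  apply: ltr_leD; last by apply: ler_sum => X _; exact: le.
  rewrite ltr_pM2l // mulrC ltr_pdivrMr ?ltr0n // -natrM ltr_nat mulnC.
  by move: (h X0); rewrite X0p /= -ltnNge.
by rewrite ltNge up.
Qed.

(** A real-valued distribution is made uniform over a list by extracting a light set for every
    weighting and feeding these to [uniform_cover]. *)
Lemma fragile_cc_uniformly C : fractionally_fragile cc C -> uniformly_fragile C.
Proof.
move=> hC N N0.
have N4 : (0 < 2 * (2 * N))%N by rewrite !muln_gt0.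
have N2 : (0 < 2 * N)%N by rewrite !muln_gt0.
have [|k hk] := hC ((2 * (2 * N))%:R^-1)%R; first by rewrite invr_gt0 ltr0n.
exists k.+1 => G CG; have [pi [dpi tpi hpi]] := hk G CG.
have [|Xs [s0 hX hc]] := @uniform_cover _
  (fun X => (cc (restrict (@gadj G) (~: X)) <= k.+1)%N) _ N2.
  move=> c; have [X X0 hX] := light_set (fun v => 2 ^ c v)%N N4 dpi tpi.
  by exists X => //; apply/cc_restrict_setC/hpi.
by exists Xs; split=> // v; have := hc v; rewrite -mulnA leq_pmul2l.
Qed.

(** * Separators from treewidth fragility *)

Lemma tw_tree_decomposition (T : finType) (e : rel T) k :
  (tw e <= k)%N -> tree_decomposition_of_width e k.
Proof.
rewrite /tw; case: ex_minnP => w /asboolP [m [t [B [h1 h2 h3 h4 h5]]]] _ wk.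
by exists m, t, B; split=> // i; apply: leq_trans (h5 i) _.
Qed.

(** Two deletions of at most |W|/(2N) vertices each: a random set, light on [W], leaves treewidth at
    most [k], and the tree separator with s = 2N(k+1) does the rest. *)
Lemma fragile_tw_separable C : fractionally_fragile tw C -> vertex_separable C.
Proof.
move=> hC N N0; have N2 : (0 < 2 * N)%N by rewrite muln_gt0.
have [|k hk] := hC ((2 * N)%:R^-1)%R; first by rewrite invr_gt0 ltr0n.
exists (2 * N * k.+1)%N => G CG W; have [pi [dpi tpi hpi]] := hk G CG.
have [X X0 hX] := light_set (fun v => (v \in W) : nat) N2 dpi tpi.
have cX : (2 * N * #|X :&: W| <= #|W|)%N.
  have -> : #|W| = (\sum_v (v \in W))%N by rewrite -sum1_card big_mkcond.
  suff -> : #|X :&: W| = (\sum_(v in X) (v \in W))%N by [].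
  rewrite -sum1_card big_mkcond [RHS]big_mkcond /=; apply: eq_bigr => v _.
  by rewrite inE; case: (v \in X).
have [m [t [B [tree_t covV covE conn width]]]] := tw_tree_decomposition (hpi X X0).
have [|||||| Y hY ccY] := @tree_decomposition_separator _ (@gadj G) m t
   (fun i => [set val v | v in B i]) (~: X) k (2 * N * k.+1) _ tree_t _ _ _ _ (W :\: X).
- by rewrite muln_gt0 N2.
- move=> v; rewrite inE => vX; have [i vi] := covV (Sub v vX).
  by exists i; apply/imsetP; exists (Sub v vX).
- move=> u v; rewrite !inE => uX vX euv.
  have [i /andP [ui vi]] := covE (Sub u uX) (Sub v vX) euv.
  by exists i; apply/andP; split; apply/imsetP; [exists (Sub u uX)|exists (Sub v vX)].
- move=> v i j /imsetP [v1 vi E1] /imsetP [v2 vj E2].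
  have E : v1 = v2 by apply: val_inj; rewrite -E1 -E2.
  rewrite -E in vj; apply: connect_sub (conn _ _ _ vi vj) => a b /and3P [tab va vb].
  by apply: connect1; rewrite /= tab E1 !imset_f.
- by move=> i; apply: leq_trans (leq_imset_card _ _) (width i).
- by apply/subsetP => v; rewrite !inE => /andP [].
exists (X :&: W :|: Y).
  have h1 : (#|X :&: W :|: Y| <= #|X :&: W| + #|Y|)%N by rewrite cardsU leq_subr.
  have h2 : (2 * N * #|Y| <= #|W|)%N.
    rewrite -(leq_pmul2l (m := k.+1)) //; apply: leq_trans (leq_mul (leqnn _) _).
      by rewrite mulnA [(k.+1 * _)%N]mulnC; exact: hY.
    by apply/subset_leq_card/subsetDl.
  have := leq_mul (leqnn N) h1; lia.
apply: sub_cc ccY => x y; rewrite /restrict /= !inE.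
by case/and3P=> ->; case: (x \in X); case: (y \in X); case: (x \in W); case: (y \in W);
   case: (x \in Y); case: (y \in Y).
Qed.

Lemma hyperfinite_tw C : monotone C -> hyperfinite C ->
  fractionally_fragile tw C /\ bounded_degree C.
Proof.
move=> monC hC; have bd := hyperfinite_bounded_degree monC hC; split=> // eps eps0.
have [k hk] := uniformly_fragile_cc
  (separable_fragile bd (hyperfinite_separable monC bd hC)) eps0.
exists k => G CG; have [pi [h1 h2 h3]] := hk G CG; exists pi; split=> // X X0.
apply: leq_trans (h3 X X0); apply: tw_le_cc => x y; exact: gsym.
Qed.

(** * Valued structures *)

Section LnDist.
Local Open Scope ring_scope.

Lemma ln_distC a b : ln_dist a b = ln_dist b a.
Proof. by rewrite /ln_dist andbC orbC distrC. Qed.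

Lemma ratr_gt0_of_ge0 (a : rat) : 0 <= a -> a != 0 -> 0 < (ratr a : R).
Proof. by move=> a0 na; rewrite ltr0q lt_neqAle eq_sym na. Qed.

Lemma ln_dist_le_mul (a b : rat) (d : R) : 0 <= a -> 0 <= b ->
  (ln_dist a b <= d%:E)%E -> ratr b <= expR d * ratr a.
Proof.
move=> a0 b0; rewrite /ln_dist; have [->|na] := eqVneq a 0; have [->|nb] := eqVneq b 0 => //=.
- by rewrite raddf0 mulr0.
have pa := ratr_gt0_of_ge0 a0 na; have pb := ratr_gt0_of_ge0 b0 nb.
rewrite lee_fin ler_distl => /andP [h _].
rewrite -[ratr b]lnK ?posrE // -[ratr a]lnK ?posrE // -exp.expRD ler_expR.
lra.
Qed.

Lemma ln_dist_le_of_mul (a b : rat) (d : R) : 0 <= d -> 0 <= b -> b <= a ->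
  expR (- d) * ratr a <= ratr b -> (ln_dist a b <= d%:E)%E.
Proof.
move=> d0 b0 ba h; have a0 := le_trans b0 ba.
rewrite /ln_dist; have [Ea|na] := eqVneq a 0.
  have -> : b = 0 by apply/eqP; rewrite eq_le b0 -Ea ba.
  by rewrite eqxx /= lee_fin.
have pa := ratr_gt0_of_ge0 a0 na.
have pb : 0 < (ratr b : R) by apply: lt_le_trans h; rewrite mulr_gt0 // expR_gt0.
have nb : b != 0 by apply: contraTneq pb => ->; rewrite raddf0 ltxx.
rewrite (negbTE nb) /= lee_fin ler_distl.
have h1 : ln (ratr b : R) <= ln (ratr a) by rewrite ler_ln ?posrE // ler_rat.
have h2 : - d + ln (ratr a) <= ln (ratr b : R).
  by rewrite -ler_expR exp.expRD !lnK ?posrE.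
by apply/andP; split; lra.
Qed.

End LnDist.

Section Opt.
Local Open Scope ring_scope.
Variable s : signature.

Definition opt_val (A B : structure s) (h : {ffun 'I_(dom_size A) -> 'I_(dom_size B)}) : rat :=
  \sum_(f : 'I_(size s)) \sum_(x : (arity f).-tuple 'I_(dom_size A))
    sfun A f x * sfun B f (map_tuple h x).

Lemma opt_val_ge0 A B h : 0 <= @opt_val A B h.
Proof. by do 2![apply: sumr_ge0 => ? _]; rewrite mulr_ge0 ?sfun_ge0. Qed.

Lemma opt_val_le A B h : @opt_val A B h <= opt A B.
Proof. exact: Order.TotalTheory.le_bigmax. Qed.

Lemma opt_attained A B : exists h, opt A B = @opt_val A B h.
Proof.
have [||h _ E] := @Order.TotalTheory.eq_bigmax _ rat _ 0
    [ffun => Ordinal (dom_size_gt0 _ B)] xpredT (@opt_val A B) => //.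
  by move=> h _; exact: opt_val_ge0.
by exists h; exact: E.
Qed.

Lemma opt_ge0 (A B : structure s) : 0 <= opt A B.
Proof. by have [h ->] := opt_attained A B; exact: opt_val_ge0. Qed.

Lemma opt_le_of_d_opt (A B : structure s) (d : R) : (d_opt A B <= d%:E)%E ->
  forall K : structure s, ratr (opt B K) <= expR d * ratr (opt A K) :> R /\
    ratr (opt A K) <= expR d * ratr (opt B K) :> R.
Proof.
move=> h K.
have hK : (ln_dist (opt A K) (opt B K) <= d%:E)%E.
  by apply: le_trans h; apply: ereal_sup_ubound; exists K.
by split; apply: ln_dist_le_mul; rewrite ?opt_ge0 // ln_distC.
Qed.

End Opt.

(** * Disjoint unions of restricted copies *)

Lemma count_touch (T : finType) (Xs : seq {set T}) (x : seq T) :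
  (count (fun X : {set T} => ~~ all (fun v => v \notin X) x) Xs <=
   \sum_(v <- x) count (fun X : {set T} => v \in X) Xs)%N.
Proof.
elim: x => [|v x IH]; first by rewrite big_nil count_pred0.
rewrite big_cons; apply: leq_trans (leq_add (leqnn _) IH).
rewrite -count_predUI; apply: leq_trans (leq_addr _ _).
by apply: sub_count => X /=; rewrite negb_and negbK.
Qed.

Section Copies.
Local Open Scope ring_scope.
Variables (s : signature) (A : structure s).
Let n := dom_size A.
Variable Xs : seq {set 'I_n}.
Hypothesis Xs_gt0 : (0 < size Xs)%N.
Let q := size Xs.
Let X (i : 'I_q) : {set 'I_n} := tnth (in_tuple Xs) i.
Let dom := ('I_q * 'I_n)%type.

Definition copy_elt (i : 'I_q) (v : 'I_n) : 'I_#|{: dom}| := enum_rank (i, v).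

Definition avoids (Y : {set 'I_n}) (x : seq 'I_n) : bool := all (fun v => v \notin Y) x.

Lemma copies_dom_gt0 : (0 < #|{: dom}|)%N.
Proof.
apply/card_gt0P; exists (Ordinal Xs_gt0, Ordinal (dom_size_gt0 _ A)).
by rewrite inE.
Qed.

(* Summing over [i] also counts a nullary tuple once per copy, so that nullary
   symbols keep their value. *)
Definition copies_sfun (f : 'I_(size s)) (y : (arity f).-tuple 'I_#|{: dom}|) : rat :=
  \sum_(i < q) \sum_(x : (arity f).-tuple 'I_n |
      (map_tuple (copy_elt i) x == y) && avoids (X i) x)
    sfun A f x / q%:R.

Lemma copies_sfun_ge0 f y : 0 <= @copies_sfun f y.
Proof. by do 2![apply: sumr_ge0 => ? _]; rewrite divr_ge0 ?sfun_ge0. Qed.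

Definition copies : structure s :=
  Struct s _ copies_dom_gt0 copies_sfun copies_sfun_ge0.

Lemma opt_val_copies (K : structure s) (h : {ffun 'I_#|{: dom}| -> 'I_(dom_size K)}) :
  @opt_val s copies K h =
  \sum_(i < q) \sum_(f : 'I_(size s)) \sum_(x : (arity f).-tuple 'I_n | avoids (X i) x)
    sfun A f x * sfun K f (map_tuple (fun v => h (copy_elt i v)) x) / q%:R.
Proof.
rewrite [RHS]exchange_big /=; apply: eq_bigr => f _.
under [LHS]eq_bigr => y _ do rewrite /= /copies_sfun big_distrl /=.
rewrite exchange_big /=; apply: eq_bigr => i _.
under [LHS]eq_bigr => y _ do rewrite big_distrl /=.
rewrite (exchange_big_dep (fun x : (arity f).-tuple 'I_n => avoids (X i) x)) /=; last first.
  by move=> y x _ /andP [].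
apply: eq_bigr => x xX; rewrite (big_pred1 (map_tuple (copy_elt i) x)); last first.
  by move=> y /=; rewrite xX andbT eq_sym.
rewrite mulrAC; congr (_ * sfun K f _ / _); apply: val_inj => /=.
by rewrite -map_comp.
Qed.

(** On each copy, a map to [K] restricts to a map from [A]; dropping tuples only loses nonnegative
    terms, so each of the [q] copies gains at most [opt A K / q]. *)
Lemma opt_copies_le K : opt copies K <= opt A K.
Proof.
have [h ->] := opt_attained copies K; rewrite opt_val_copies.
have q0 : 0 < q%:R :> rat by rewrite ltr0n.
apply: (@le_trans _ _ (\sum_(i < q) opt A K / q%:R)); last first.
  by rewrite sumr_const card_ord -[leLHS]mulr_natr divfK // gt_eqF.
apply: ler_sum => i _.
pose g : {ffun 'I_n -> 'I_(dom_size K)} := [ffun v => h (copy_elt i v)].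
apply: (@le_trans _ _ (@opt_val s A K g / q%:R)); last first.
  by rewrite ler_pM2r ?invr_gt0 // opt_val_le.
rewrite mulr_suml; apply: ler_sum => f _; rewrite mulr_suml.
rewrite [leRHS](bigID (fun x : (arity f).-tuple 'I_n => avoids (X i) x)) /=.
apply: ler_wpDr; first by apply: sumr_ge0 => x _; rewrite divr_ge0 ?mulr_ge0 ?sfun_ge0.
apply: ler_sum => x _; rewrite ler_pM2r ?invr_gt0 //.
suff -> : map_tuple (fun v => h (copy_elt i v)) x = map_tuple g x by [].
by apply: val_inj; apply: eq_map => v; rewrite ffunE.
Qed.

(** Use an optimal map of [A] on every copy. By a union bound over its at most [r] entries, a tuple
    is lost in at most a fraction r/N of the copies. *)
Lemma le_opt_copies K (N r : nat) : (0 < N)%N -> all (fun a => (a <= r)%N) s ->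
  (forall v, (N * count (fun Y : {set 'I_n} => v \in Y) Xs <= q)%N) ->
  (N%:R - r%:R) * opt A K <= N%:R * opt copies K.
Proof.
move=> N0 sr hc; have [h ->] := opt_attained A K.
have q0 : 0 < q%:R :> rat by rewrite ltr0n.
pose g : {ffun 'I_#|{: dom}| -> 'I_(dom_size K)} := [ffun y => h (enum_val y).2].
apply: (@le_trans _ _ (N%:R * @opt_val s copies K g)); last first.
  by rewrite ler_pM2l ?ltr0n // opt_val_le.
rewrite opt_val_copies exchange_big /= !big_distrr /=; apply: ler_sum => f _.
have Eg i x : map_tuple (fun v => g (copy_elt i v)) x = map_tuple h x :> (arity f).-tuple _.
  by apply: val_inj; apply: eq_map => v; rewrite ffunE enum_rankK.
under [X in _ <= _ * X]eq_bigr => i _ do under eq_bigr => x _ do rewrite Eg.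
rewrite (exchange_big_dep xpredT) //= !big_distrr /=; apply: ler_sum => x _.
set c := sfun A f x * _; have c0 : 0 <= c by rewrite mulr_ge0 ?sfun_ge0.
rewrite sumr_const -[X in _ <= _ * X]mulr_natr; set M := #|_|.
have -> : N%:R * (c / q%:R * M%:R) = c * (N%:R * M%:R / q%:R) by ring.
rewrite [leLHS]mulrC ler_wpM2l // ler_pdivlMr //.
rewrite mulrBl -!natrM lerBlDr -natrD ler_nat.
have -> : M = count (fun Y => avoids Y x) Xs.
  rewrite /M -sum1_card -[in RHS](in_tupleE Xs) -sum1_count.
  by rewrite [RHS]big_tnth.
have := count_predC (fun Y : {set 'I_n} => avoids Y x) Xs; rewrite -/q => E.
have ht : (N * count (predC (fun Y : {set 'I_n} => avoids Y x)) Xs <= r * q)%N.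
  apply: leq_trans (leq_mul (leqnn _) (count_touch Xs x)) _.
  rewrite big_distrr /=; apply: (@leq_trans (\sum_(v <- x) q)).
    by apply: leq_sum => v _; exact: hc.
  rewrite big_const_seq count_predT iter_addn_0 size_tuple mulnC leq_mul2r.
  by apply/orP; right; apply: (allP sr); apply: mem_nth.
by rewrite -E mulnDr; move: ht; rewrite -E; lia.
Qed.

(** A tuple of positive value comes from one copy and avoids the set deleted there, so a path stays
    in its copy and projects to a path of [A] outside that set. *)
Lemma cc_copies k : (forall Y, Y \in Xs -> (cc (restrict (gaif_adj A) (~: Y)) <= k)%N) ->
  (cc_struct copies <= k)%N.
Proof.
move=> hk; apply/cc_leP => y0.
have [[i0 v0] E0] : exists p : dom, y0 = enum_rank p by exists (enum_val y0); rewrite enum_valK.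
have /cc_leP/(_ v0) := hk (X i0) (mem_tnth _ _); apply: leq_trans.
apply: leq_trans (leq_imset_card (copy_elt i0) _).
apply/subset_leq_card/subsetP => u; rewrite inE => /connectP [p].
suff key : forall v, path (gaif_adj copies) (copy_elt i0 v) p ->
    exists2 z, connect (restrict (gaif_adj A) (~: X i0)) v z &
      last (copy_elt i0 v) p = copy_elt i0 z.
  rewrite E0 => pp ->; have [z cz ->] := key v0 pp.
  by apply: imset_f; rewrite inE.
elim: p => [|y p IH] v /=; first by exists v.
case/andP=> /andP [ne /existsP [f /existsP [x /and3P [x0 vx yx]]]] pp.
have [i [x' [Ex ax x'0]]] : exists i (x' : (arity f).-tuple 'I_n),
    [/\ x = map_tuple (copy_elt i) x', avoids (X i) x' & 0 < sfun A f x'].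
  move: x0 => /=; rewrite /copies_sfun => x0.
  have [/existsP [i /existsP [x' /and3P [/eqP h1 h2 h3]]]|/existsPn hn] :=
    boolP [exists i, exists x' : (arity f).-tuple 'I_n,
      [&& x == map_tuple (copy_elt i) x', avoids (X i) x' & 0 < sfun A f x']].
    by exists i, x'.
  move: x0; rewrite big1 ?ltxx // => i _; apply: big1 => x' /andP [/eqP h1 h2].
  have /existsPn/(_ x') := hn i; rewrite h1 eqxx h2 /= -leNgt => h3.
  have -> : sfun A f x' = 0 by apply/eqP; rewrite eq_le h3 sfun_ge0.
  by rewrite mul0r.
move: vx yx; rewrite Ex => /mapP [v' v'x /enum_rank_inj [Ei Ev]] /mapP [z zx Ey].
rewrite -{}Ei in Ex ax Ey; rewrite -{}Ev in v'x.
have [z' cz' Ez'] := IH z ltac:(by rewrite -Ey).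
exists z'; last by rewrite -Ez' Ey.
apply: connect_trans cz'; apply: connect1; rewrite /restrict /= !inE.
rewrite (allP ax _ v'x) (allP ax _ zx) !andbT; apply/andP; split.
  by apply: contraNneq ne => ->; rewrite Ey.
by apply/existsP; exists f; apply/existsP; exists x'; rewrite x'0 v'x.
Qed.

End Copies.

Lemma fragile_pliable C r :
  fractionally_fragile cc C -> cc_pliable (struct_class_of C r).
Proof.
move=> /fragile_cc_uniformly hC eps eps0.
have e1 : (0 < 1 - expR (- eps) :> R)%R by rewrite subr_gt0 expR_lt1 oppr_lt0.
(* Chosen so that 1 - r/N >= exp(-eps). *)
pose N := (Num.truncn (r%:R / (1 - expR (- eps)) : R)%R).+1.
have [k hk] := hC N isT; exists k => s A [CA sr].
have [Xs [s0 hX hc]] := hk _ CA.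
exists (copies s0); split; first exact: cc_copies.
apply: ge_ereal_sup => _ [K ->].
apply: ln_dist_le_of_mul;
  [exact: ltW | exact: opt_ge0 | exact: opt_copies_le | ].
have N0 : (0 < N%:R :> R)%R by rewrite ltr0n.
have := @le_opt_copies s A Xs s0 K N r isT sr hc.
rewrite -(ler_rat R) !rmorphM rmorphB /= !ratr_nat => h.
rewrite -(ler_pM2l N0) mulrA; apply: le_trans h; rewrite ler_wpM2r ?ler0q ?opt_ge0 //.
have : (r%:R / (1 - expR (- eps)) <= N%:R :> R)%R by rewrite ltW // truncnS_gt.
by rewrite ler_pdivrMr // mulrBr mulr1; lra.
Qed.

(** * From pliability to hyperfiniteness *)

Section EdgeStructures.
Local Open Scope ring_scope.
Variable G : graph.
Let n := gn G.
Hypothesis n_gt0 : (0 < n)%N.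
Let pair_type := ('I_n * 'I_n)%type.

(** With a symbol for each pair, a map gains an edge only by sending its ends to their own copies.
    Pairs that are not edges get the zero function. *)
Definition edge_sig : signature := nseq #|{: pair_type}| 2.

Definition edge_of (f : 'I_(size edge_sig)) : pair_type :=
  enum_val (cast_ord (size_nseq _ _) f).

Lemma edge_of_bij : bijective edge_of.
Proof.
exists (fun p => cast_ord (esym (size_nseq _ _)) (enum_rank p)) => [f|p].
  by rewrite /edge_of enum_valK cast_ordK.
by rewrite /edge_of cast_ordKV enum_rankK.
Qed.

Lemma arity_edge_sig (f : 'I_(size edge_sig)) : arity f = 2.
Proof.
by rewrite /arity nth_nseq; move: (ltn_ord f); rewrite {2}size_nseq => ->.
Qed.

(** Tuples are compared as sequences because [arity f] is 2 only propositionally. *)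
Definition edge_sfun (f : 'I_(size edge_sig)) (x : (arity f).-tuple 'I_n) : rat :=
  ((edge_of f \in edges G) && (val x == [:: (edge_of f).1; (edge_of f).2]))%:R.

Lemma edge_sfun_ge0 f x : 0 <= @edge_sfun f x.
Proof. exact: ler0n. Qed.

Definition edge_struct : structure edge_sig :=
  Struct edge_sig n n_gt0 edge_sfun edge_sfun_ge0.

Lemma gaifman_edge_struct : subgraph (gaifman edge_struct) G.
Proof.
exists id; split=> // u v /andP [uv /existsP [f /existsP [x /and3P [x0 ux vx]]]].
move: x0; rewrite ltr0n lt0b => /andP [ed /eqP Ex].
move: ux vx uv ed; rewrite !memtE Ex !inE.
by case/orP=> /eqP -> /orP [] /eqP ->; rewrite ?eqxx // => _ /andP [_]; rewrite // gsym.
Qed.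

Lemma card_edges_le_opt : #|edges G|%:R <= opt edge_struct edge_struct.
Proof.
apply: le_trans (@opt_val_le _ edge_struct edge_struct [ffun v => v]).
rewrite -sum1_card natr_sum big_mkcond /= (reindex edge_of) /=; last exact: onW_bij edge_of_bij.
apply: ler_sum => f _; case: ifP => [ed|_]; last first.
  by apply: sumr_ge0 => x _; rewrite mulr_ge0 ?edge_sfun_ge0.
have sz : size [:: (edge_of f).1; (edge_of f).2] == arity f by rewrite arity_edge_sig.
rewrite (bigD1 (Tuple sz)) //= ler_wpDr //.
  by apply: sumr_ge0 => x _; rewrite mulr_ge0 ?edge_sfun_ge0.
by rewrite /edge_sfun ed /= !ffunE !eqxx mulr1.
Qed.

Variable k : nat.
Let piece_type := ({set 'I_n} * 'I_n)%type.

Definition piece_elt (S : {set 'I_n}) (v : 'I_n) : 'I_#|{: piece_type}| := enum_rank (S, v).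

(** Whether [p] is an edge is left to [edge_struct], which vanishes on the symbols of other
    pairs. *)
Definition in_piece (p : pair_type) (y : seq 'I_#|{: piece_type}|) : bool :=
  [exists S : {set 'I_n}, [&& (#|S| <= k)%N, p.1 \in S, p.2 \in S &
     y == [:: piece_elt S p.1; piece_elt S p.2]]].

Lemma pieces_dom_gt0 : (0 < #|{: piece_type}|)%N.
Proof. by apply/card_gt0P; exists (finset.set0, Ordinal n_gt0); rewrite inE. Qed.

Definition pieces_sfun (f : 'I_(size edge_sig))
    (y : (arity f).-tuple 'I_#|{: piece_type}|) : rat :=
  (in_piece (edge_of f) y)%:R.

Lemma pieces_sfun_ge0 f y : 0 <= @pieces_sfun f y.
Proof. exact: ler0n. Qed.

(* The disjoint union of the graphs induced on the vertex sets of size at most [k]. *)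
Definition pieces_struct : structure edge_sig :=
  Struct edge_sig _ pieces_dom_gt0 pieces_sfun pieces_sfun_ge0.

(* A map from [B] sends each component of [B] onto at most [k] vertices, that is,
   into a single piece. *)
Lemma opt_le_opt_pieces (B : structure edge_sig) :
  (cc_struct B <= k)%N -> opt B edge_struct <= opt B pieces_struct.
Proof.
move=> /cc_leP ccB; have [h ->] := opt_attained B edge_struct.
have cs := sym_connect_sym (@gaif_sym _ B).
pose comp y : {set 'I_n} := [set h u | u in [set u | connect (gaif_adj B) y u]].
pose g : {ffun 'I_(dom_size B) -> 'I_(dom_size pieces_struct)} :=
  [ffun y => piece_elt (comp y) (h y)].
apply: le_trans (@opt_val_le _ B pieces_struct g).
apply: ler_sum => f _; apply: ler_sum => x _.
have [x0|x0] := eqVneq (sfun B f x) 0; first by rewrite x0 !mul0r.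
rewrite ler_wpM2l ?sfun_ge0 //= /edge_sfun /pieces_sfun ler_nat.
case: andP => // -[_ /= /eqP Ex].
case Dx: (tval x) Ex => [|y1 [|y2 [|? ?]]] //= [E1 E2].
have c12 : connect (gaif_adj B) y1 y2.
  have [-> //|ne] := eqVneq y1 y2; apply: connect1; rewrite /gaif_adj ne /=.
  apply/existsP; exists f; apply/existsP; exists x.
  by rewrite lt_neqAle eq_sym x0 sfun_ge0 !memtE Dx !inE !eqxx orbT.
suff -> : in_piece (edge_of f) [:: g y1; g y2] by [].
apply/existsP; exists (comp y1); apply/and4P; split.
- exact: leq_trans (leq_imset_card _ _) (ccB y1).
- by rewrite -E1 imset_f // inE connect0.
- by rewrite -E2 imset_f // inE.
rewrite !ffunE E1 E2 /comp.
suff -> : [set u | connect (gaif_adj B) y2 u] = [set u | connect (gaif_adj B) y1 u] by [].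
by apply/setP => u; rewrite !inE (same_connect cs c12).
Qed.

(** Cut the edges that an optimal map does not gain. Both ends of any other edge go to their copies
    in one piece, which is then the same along a component. The successor allows for isolated
    vertices when [k = 0]. *)
Lemma edge_cut_of_opt_pieces : exists F : {set pair_type},
  [/\ F \subset edges G,
      opt edge_struct pieces_struct <= #|edges G|%:R - #|F|%:R &
      (cc (@del_edges G F) <= k.+1)%N].
Proof.
have [h Eh] := opt_attained edge_struct pieces_struct.
pose good (p : pair_type) := in_piece p [:: h p.1; h p.2].
pose F := [set p in edges G | ~~ good p].
have FE : F \subset edges G by apply/subsetP => p; rewrite inE => /andP [].
have goodE u v : del_edges F u v -> exists2 S : {set 'I_n}, (#|S| <= k)%N &
    [/\ u \in S, v \in S, h u = piece_elt S u & h v = piece_elt S v].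
  case/and3P=> uv Fuv Fvu.
  have [lt|gt|E] := ltngtP u v; last by move: uv; rewrite (val_inj E) girr.
    have /existsP [S /and4P [h1 h2 h3 /eqP [h4 h5]]] : good (u, v).
      by move: Fuv; rewrite !inE /= lt uv /= negbK.
    by exists S.
  have /existsP [S /and4P [h1 h2 h3 /eqP [h4 h5]]] : good (v, u).
    by move: Fvu; rewrite !inE /= gt gsym uv /= negbK.
  by exists S.
exists F; split=> //.
  rewrite -natrB ?subset_leq_card // -cardsDS // -sum1_card natr_sum big_mkcond /=.
  rewrite (reindex edge_of) /=; last exact: onW_bij edge_of_bij.
  rewrite Eh; apply: ler_sum => f _; case: ifP => [_|nF].
    apply: (@le_trans _ _ (\sum_(x : (arity f).-tuple 'I_n)
        (val x == [:: (edge_of f).1; (edge_of f).2])%:R)).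
      apply: ler_sum => x _; rewrite /= /edge_sfun /pieces_sfun -natrM mulnb ler_nat.
      by rewrite -andbA andbCA; case: eqP => //= _; exact: leq_b1.
    (* Each symbol has at most one tuple of positive value in [edge_struct], so it gains at most
       1. *)
    rewrite -natr_sum ler_nat -big_mkcond /= sum1_card.
    apply/card_le1P => x; rewrite unfold_in => /eqP Ex y; rewrite !unfold_in /= -Ex.
    by apply/eqP/eqP => [/val_inj|->].
  rewrite big1 // => x _; rewrite /= /edge_sfun /pieces_sfun.
  case: andP => [[ed /eqP Ex]|_]; last by rewrite mul0r.
  move: nF; rewrite in_setD ed andbT => /negbFE; rewrite inE => /andP [_ /negbTE bad].
  have -> : tval (map_tuple h x) = [:: h (edge_of f).1; h (edge_of f).2] by rewrite /= Ex.
  by rewrite -/(good _) bad mulr0.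
apply/cc_leP => v.
have [/existsP [y vy]|/existsPn iso] := boolP [exists y, del_edges F v y]; last first.
  by rewrite component_isolated // cards1.
have [S cS [vS _ hv _]] := goodE _ _ vy.
pose K := [set u in S | h u == piece_elt S u].
have vK : v \in K by rewrite inE vS hv eqxx.
apply: leq_trans (leqW cS); apply/subset_leq_card/subsetP => u; rewrite inE => c.
have [] := @connect_closed _ _ (@del_edges G F) K v u _ vK c;
  last by move=> _; rewrite inE => /andP [].
move=> x z; rewrite inE => /andP [xS /eqP hx] exz; split=> //.
have [S' _ [_ zS' hx' hz']] := goodE _ _ exz.
have E : S' = S by move: hx'; rewrite hx => /enum_rank_inj [->].
by rewrite inE -E zS' hz' eqxx.
Qed.

End EdgeStructures.

Lemma pliable_hyperfinite C r : monotone C -> (2 <= r)%N ->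
  cc_pliable (struct_class_of C r) -> hyperfinite C.
Proof.
move=> monC r2 hC eps eps0.
have [|k hk] := hC (eps / 2)%R; first by rewrite divr_gt0.
(* Structures have nonempty domains, so the empty graph is treated apart. *)
exists k.+1 => G CG; have [n0|n_gt0] := posnP (gn G).
  exists finset.set0; split; first exact: sub0set.
    by rewrite cards0 mulr_ge0 // ltW.
  by apply/cc_leP => -[m hm]; exfalso; move: hm; rewrite n0.
have [|B [ccB dB]] := hk _ (edge_struct n_gt0).
  split; first exact: monC CG (gaifman_edge_struct n_gt0).
  by rewrite all_nseq r2 orbT.
have [F [FE hF ccF]] := edge_cut_of_opt_pieces n_gt0 k.
exists F; split=> //.
have [hBA _] := opt_le_of_d_opt dB (pieces_struct n_gt0 k).
have [_ hAB] := opt_le_of_d_opt dB (edge_struct n_gt0).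
move: (opt_le_opt_pieces n_gt0 ccB) (card_edges_le_opt n_gt0) hF.
rewrite -!(ler_rat R) rmorphB /= !ratr_nat.
set E : R := (#|edges G|%:R)%R; set x : R := (#|F|%:R)%R => h1 h2 h3.
have e0 : (0 <= expR (eps / 2) :> R)%R by exact: expR_ge0.
(* With A for [edge_struct] and K for the pieces: E <= opt(A,A) <= e^(eps/2) opt(B,A) <= e^(eps/2)
   opt(B,K) <= e^eps opt(A,K) <= e^eps (E - x). *)
have hE : (E <= expR eps * (E - x))%R.
  have -> : (eps = eps / 2 + eps / 2)%R by lra.
  rewrite exp.expRD -mulrA.
  apply: le_trans h2 (le_trans hAB (ler_wpM2l e0 _)).
  exact: le_trans h1 (le_trans hBA (ler_wpM2l e0 h3)).
have h4 : (expR (- eps) * E <= E - x)%R by rewrite expRN mulrC ler_pdivrMr ?expR_gt0 // mulrC.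
have h5 : ((1 - eps) * E <= expR (- eps) * E)%R.
  by rewrite ler_wpM2r ?ler0n // expR_ge1Dx.
by move: (le_trans h5 h4); rewrite mulrBl mul1r; lra.
Qed.

Theorem theorem6 (C : graph_class) (r : nat) :
  monotone C -> (2 <= r)%N ->
  [<-> hyperfinite C;
       fractionally_fragile tw C /\ bounded_degree C;
       fractionally_fragile cc C;
       cc_pliable (struct_class_of C r)].
Proof.
move=> monC r2; tfae.
- exact: hyperfinite_tw.
- by move=> [tC bC]; apply: uniformly_fragile_cc; apply: separable_fragile => //;
     exact: fragile_tw_separable.
- exact: fragile_pliable.
- exact: pliable_hyperfinite.
Qed.
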